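(* Let $(t_0,z_0)\in\mathbb R^{2d+1}$, $z_0=(q_0,p_0)$ with $w(q_0)\neq0$, be such that the trajectory $\Phi_-^{t,t_0}(z_0)=(q_-(t),p_-(t))$ reaches $\Upsilon$ at time $t^\flat>t_0$ and point $z^\flat=(q^\flat,p^\flat)=\Phi_-^{t^\flat,t_0}(z_0)$, a non-degenerate conical crossing point with $dw(q^\flat)p^\flat=r\omega$, $r>0$, $|\omega|=1$. Let $\vec Y_0\in\mathbb R^2$ be a unit vector with $\Pi_-(q_0)\vec Y_0=\vec Y_0$. Then the solution $\vec Y_-(t)$ of $$\partial_t\vec Y_-(t)=B_-(\Phi_-^{t,t_0}(z_0))\vec Y_-(t),\quad t\in[t_0,t^\flat),\qquad\vec Y_-(t_0)=\vec Y_0$$ satisfies: (1) for all $t\in[t_0,t^\flat)$, $\Pi_-(q_-(t))\vec Y_-(t)=\vec Y_-(t)$. (2) There exists a normalized real-valued vector $\vec V_\omega\in\mathbb R^2$, $|\vec V_\omega|=1$, such that $\lim_{t\to t^\flat,\,t<t^\flat}\vec Y_-(t)=\vec V_\omega$ and $\begin{pmatrix}\omega_1&\omega_2\\ \omega_2&-\omega_1\end{pmatrix}\vec V_\omega=\vec V_\omega$. (3) There exist $\tau>0$ and a function $x\mapsto\vec V_-(x)$, smooth in a neighborhood of $\{q_-(t):t\in[t^\flat-\tau,t^\flat)\}$, such that $\Pi_-\vec V_-=\vec V_-$ and $\vec Y_-(t)=\vec V_-(q_-(t))$ for $t\in[t^\flat-\tau,t^\flat)$.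
   Context: $A(w)=\begin{pmatrix}w_1&w_2\\ w_2&-w_1\end{pmatrix}$ for $w\in\mathbb R^2$. $V(x)=v(x)\mathrm{Id}+A(w(x))$ with $v\in C^\infty(\mathbb R^d,\mathbb R)$, $w\in C^\infty(\mathbb R^d,\mathbb R^2)$, $\sup_x\|\partial^\gamma V(x)\|<\infty$ for $|\gamma|\ge2$; $\lambda_\pm=v\pm|w|$; there are $c_0,n_0,r_0>0$ with $|\lambda_+-\lambda_-|(x)\ge c_0\langle x\rangle^{-n_0}$ when $|w(x)|\ge r_0$. $\Upsilon=\{w=0\}$ (one says indifferently $q\in\Upsilon$ or $(q,p)\in\Upsilon$), and the $2\times d$ Jacobian $dw(q)$ has rank 2 at every $q\in\Upsilon$. A point $z^\flat=(q^\flat,p^\flat)\in\Upsilon$ is a non-degenerate conical crossing point if $dw(q^\flat)p^\flat\ne0$. Off $\Upsilon$: $\Pi_\pm=\frac12(\mathrm{Id}\pm\frac1{|w|}A(w))$ and $B_\pm(x,\xi)=\pm\Pi_\mp(x)(\xi\cdot\nabla_x\Pi_+(x))\Pi_\pm(x)$. $\Phi_\pm^{t,t_0}(z_0)=(q_\pm(t),p_\pm(t))$ solves $\dot q=p$, $\dot p=-\nabla\lambda_\pm(q)$ with value $z_0$ at $t_0$; it extends continuously to $t^\flat$ with value $z^\flat$, and $w(q_\pm(t))=(t-t^\flat)r\omega+O((t-t^\flat)^2)$ near $t^\flat$ (known result). *)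

(* Defs.v *)
From HB Require Import structures.
From mathcomp Require Import all_boot all_order all_algebra.
From mathcomp Require Import all_classical all_reals all_analysis.

Set Implicit Arguments.
Unset Strict Implicit.
Unset Printing Implicit Defensive.

Import Order.TTheory GRing.Theory Num.Theory.
Import numFieldNormedType.Exports.

Local Open Scope classical_set_scope.
Local Open Scope ring_scope.

(* Elements of R^n are column vectors. The MathComp-Analysis norm `|u| on
   'cV[R]_n is the maximum norm: it induces the usual topology, but it is not the
   Euclidean norm |u|, which is [enorm u]. *)
Definition enorm (R : realType) (n : nat) (u : 'cV[R]_n) : R :=
  Num.sqrt (\sum_i u i 0 ^+ 2).

Definition bracket (R : realType) (n : nat) (x : 'cV[R]_n) : R :=
  Num.sqrt (1 + enorm x ^+ 2).

Section Differentiation.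
Variables (R : realType) (d : nat).

Definition partial (W : normedModType R) (i : 'I_d) (f : 'cV[R]_d -> W) :
  'cV[R]_d -> W := fun x => 'D_(delta_mx i 0) f x.

Definition multi_partial (W : normedModType R) (gam : 'I_d -> nat)
  (f : 'cV[R]_d -> W) : 'cV[R]_d -> W :=
  foldr (fun i => iter (gam i) (partial i)) f (enum 'I_d).

(* Meaningful for U open: only then do the values of f on U determine the
   partial derivatives of f on U. *)
Fixpoint Ck_on (W : normedModType R) (k : nat) (U : set 'cV[R]_d)
    (f : 'cV[R]_d -> W) : Prop :=
  (forall x, U x -> {for x, continuous f}) /\
  if k is k'.+1 then
    forall i, (forall x, U x -> derivable f x (delta_mx i 0)) /\
              Ck_on k' U (partial i f)
  else True.

Definition smooth_on (W : normedModType R) (U : set 'cV[R]_d)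
  (f : 'cV[R]_d -> W) : Prop := forall k, Ck_on k U f.

Definition grad (f : 'cV[R]_d -> R) (x : 'cV[R]_d) : 'cV[R]_d :=
  \col_i partial i f x.

(* The library's 'J is the transpose of this: it acts on row vectors. *)
Definition jacobian_mx (m : nat) (f : 'cV[R]_d -> 'cV[R]_m) (x : 'cV[R]_d) :
  'M[R]_(m, d) := \matrix_(i, j) partial j (fun y => f y i 0) x.

(* Derivative relative to I: one-sided at an endpoint of I that belongs to I,
   and the usual derivative at interior points. *)
Definition is_derive_within (W : normedModType R) (I : set R) (f : R -> W)
  (t : R) (l : W) : Prop :=
  (s - t)^-1 *: (f s - f t) @[s --> within I t^'] --> l.

End Differentiation.
Arguments is_derive_within {R W} I f t l.

Section Crossing.
Variables (R : realType) (d : nat).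
Variables (v : 'cV[R]_d -> R) (w : 'cV[R]_d -> 'cV[R]_2).

Definition Amx (u : 'cV[R]_2) : 'M[R]_2 :=
  \matrix_(i, j) if i == 0 then (if j == 0 then u 0 0 else u 1 0)
                 else (if j == 0 then u 1 0 else - u 0 0).

Definition Vmx (x : 'cV[R]_d) : 'M[R]_2 := (v x)%:M + Amx (w x).

Definition Upsilon : set 'cV[R]_d := [set x | w x = 0].

Definition nondegenerate_crossing (q p : 'cV[R]_d) : Prop :=
  Upsilon q /\ jacobian_mx w q *m p != 0.

(* In the next three definitions the sign +/- is the scalar e = 1 or e = -1. *)
Definition lambda (e : R) (x : 'cV[R]_d) : R := v x + e * enorm (w x).

(* Meaningful off Upsilon only. *)
Definition Pi (e : R) (x : 'cV[R]_d) : 'M[R]_2 :=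
  2^-1 *: (1%:M + e *: ((enorm (w x))^-1 *: Amx (w x))).

Definition Bmx (e : R) (x xi : 'cV[R]_d) : 'M[R]_2 :=
  e *: (Pi (- e) x *m (\sum_i xi i 0 *: partial i (Pi 1) x) *m Pi e x).

Definition hamiltonian_trajectory (e : R) (I : set R)
  (q p : R -> 'cV[R]_d) : Prop :=
  forall t, I t -> [/\ w (q t) <> 0, is_derive_within I q t (p t)
    & is_derive_within I p t (- grad (lambda e) (q t))].

End Crossing.

(* Main.v *)
(* Let P be Pi_+ and Z = P Y along the trajectory. Since P^2 = P, the derivative of
   P satisfies P P' P = 0, which makes |Z|^2 constant, hence Z = 0; then Y' = - P P' Y
   is orthogonal to Y and |Y| = 1. L'Hopital's rule applied to w(q(t)) / (t - t_flat)
   shows that w / |w| tends to - omega, so Pi_- tends to the projector on the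
   1-eigenline of A(omega), spanned by a unit vector V. The normalized projection
   Pi_- V / |Pi_- V| is a smooth unit eigenvector field near the end of the trajectory,
   and Y is this field up to a sign, constant by the intermediate value theorem. *)
Require Import Defs.
From HB Require Import structures.
From mathcomp Require Import all_boot all_order all_algebra.
From mathcomp Require Import all_classical all_reals all_analysis.
From mathcomp Require Import ring lra.

Set Implicit Arguments.
Unset Strict Implicit.
Unset Printing Implicit Defensive.

Import Order.TTheory GRing.Theory Num.Theory.
Import numFieldNormedType.Exports.
Local Open Scope classical_set_scope.
Local Open Scope ring_scope.

(** The cancellation that makes |Z|^2 constant: with D = P' and Y' = - P D (Y - Z), one has Z' = D Y
    - P D (Y - Z), hence <Z, Z'> = <Z, D Y> - <Z, D (Y - Z)> = <Z, D Z>, which vanishes since Z = P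
    Z and P D P = 0. The differential equation is never solved: its solution is identified up to
    sign with an explicit field. That field is built from a fixed vector V because Pi_-, as a
    function of x, has no limit at the crossing point: approaching it along opposite directions
    gives different projectors. Only the limit along the trajectory makes sense, and it selects V;
    the field then lives on the open set where w and Pi_- V do not vanish, which excludes the
    crossing point. Smoothness is expressed through partial derivatives and the time derivatives are
    one-sided at the initial time, hence a chain rule stated for arbitrary filters. *)

(** * Entrywise limits, mean value theorem and first-order expansion *)

Lemma cvg_mxP (R : realType) (T : Type) (m n : nat) (F : set_system T)
    (FF : Filter F) (f : T -> 'M[R]_(m, n)) (M : 'M[R]_(m, n)) :
  f @ F --> M <-> forall i j, f t i j @[t --> F] --> M i j.
Proof.
split=> [fM i j|fM].
  exact: (cvg_comp _ (fun N : 'M[R]_(m, n) => N i j) fM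
            (@coord_continuous _ _ _ i j M)).
apply/cvgrPdist_le => /= e e0; near=> t.
rewrite /Num.Def.normr/= mx_normrE (bigmax_le _ (ltW e0))//= => i _.
rewrite !mxE; move: i; near: t; apply: filter_forall => /= i.
exact: ((cvgrPdist_le _ _).1 (fM i.1 i.2)).
Unshelve. all: by end_near. Qed.

Lemma coord_le_mx_norm (R : realType) (m n : nat) (M : 'M[R]_(m, n)) i j :
  `|M i j| <= `|M|.
Proof.
rewrite [leRHS]/Num.Def.normr/= mx_normrE.
exact: (le_bigmax _ (fun k : 'I_m * 'I_n => `|M k.1 k.2|) (i, j)).
Qed.

Lemma mx_norm_le (R : realType) (m n : nat) (M : 'M[R]_(m, n)) e :
  0 <= e -> (forall i j, `|M i j| <= e) -> `|M| <= e.
Proof.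
move=> e0 Me; rewrite /Num.Def.normr/= mx_normrE.
by apply: bigmax_le => // -[i j] _; exact: Me.
Qed.

Lemma derivable_line (R : realType) (V W : normedModType R) (f : V -> W)
    (z u : V) (c : R) :
  derivable f (c *: u + z) u ->
  is_derive c (1 : R) (fun s => f (s *: u + z)) ('D_u f (c *: u + z)).
Proof.
have E : (fun h : R => h^-1 *: (f ((h *: (1 : R) + c) *: u + z) - f (c *: u + z))) =
         (fun h : R => h^-1 *: (f (h *: u + (c *: u + z)) - f (c *: u + z))).
  by apply/funext => h; rewrite [h *: 1]mulr1 scalerDl addrA.
by move=> df; split; rewrite /derivable /derive /= E.
Qed.

Lemma MVT_line (R : realType) (V : normedModType R) (f : V -> R) (z u : V)
    (h : R) :
  (forall c, `|c| <= `|h| -> derivable f (c *: u + z) u) ->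
  exists2 c, `|c| <= `|h| & f (h *: u + z) - f z = 'D_u f (c *: u + z) * h.
Proof.
move=> df; pose g s := f (s *: u + z); pose dg s := 'D_u f (s *: u + z).
have dgE s : `|s| <= `|h| -> is_derive s (1 : R) g (dg s).
  by move=> /df; exact: derivable_line.
have cg s : `|s| <= `|h| -> {for s, continuous g}.
  move=> /dgE gs; apply: differentiable_continuous.
  by apply/derivable1_diffP; exact: ex_derive.
have g0 : g 0 = f z by rewrite /g scale0r add0r.
(* [h] may be negative: the mean value theorem is used on [[0, h]] or on [[h, 0]]. *)
have sub a b : (forall s, s \in `[a, b]%R -> `|s| <= `|h|) -> a <= b ->
    exists2 c, `|c| <= `|h| & g b - g a = dg c * (b - a).
  move=> ab ab0; have [s sI||c /ab ch ->] := @MVT_segment R g dg a b ab0.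
  - by apply: dgE; apply: ab; exact: subset_itv_oo_cc sI.
  - by apply: continuous_in_subspaceT => s /set_mem sI; apply/cg/ab.
  - by exists c.
rewrite -g0 -/(g h); have [h0|/ltW h0] := leP 0 h.
  have [s|c ch ->] := sub 0 h _ h0; last by exists c; rewrite ?subr0.
  by rewrite in_itv/= => /andP[s0 sh]; rewrite !ger0_norm.
have [s|c ch E] := sub h 0 _ h0.
  by rewrite in_itv/= => /andP[s0 sh]; rewrite !ler0_norm// lerN2.
by exists c => //; rewrite -opprB E sub0r mulrN opprK.
Qed.

(** The points [z 0 = x], ..., [z d = y] join [x] to [y] by steps parallel to the axes, so each
    increment of a function along this path involves a single partial derivative. *)
Lemma coord_interpolation (R : realType) (d : nat) (x y : 'cV[R]_d) (k : 'I_d) :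
  let z k' : 'cV[R]_d := \col_i (if (i < k')%N then y i 0 else x i 0) in
  z k.+1 = (y k 0 - x k 0) *: delta_mx k 0 + z k.
Proof.
move=> z; apply/colP => i; rewrite !mxE eqxx andbT ltnS leq_eqVlt.
have [<-|ki] := eqVneq i k; first by rewrite eqxx ltnn/= mulr1 subrK.
by rewrite (negbTE (ki : (i : nat) != k)) mulr0 add0r.
Qed.

(* The first-order expansion of a C^1 function, by moving one coordinate at a time. *)
Lemma C1_expansion (R : realType) (d : nat) (U : set 'cV[R]_d)
    (f : 'cV[R]_d -> R) (x : 'cV[R]_d) :
  open U -> U x -> Ck_on 1 U f ->
  forall e, 0 < e -> \forall y \near x,
    `|f y - f x - \sum_i (y i 0 - x i 0) * partial i f x| <= e * `|y - x|.
Proof.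
(* Each of the [d] steps costs at most [e' * |y - x|]; dividing by [d.+1] rather than by [d] covers
   [d = 0] as well. *)
move=> oU Ux [_ f1] e e0; pose e' := e / d.+1%:R.
have e'0 : 0 < e' by rewrite divr_gt0.
have nU : \forall y \near x, U y by apply: open_nbhs_nbhs; split.
have nP : \forall y \near x, forall i, `|partial i f x - partial i f y| <= e'.
  apply: (@filter_forall _ _ (fun i y => `|partial i f x - partial i f y| <= e')
    _ (nbhs_filter x)) => i; have [_ [c _]] := f1 i.
  exact: ((cvgrPdist_le _ _).1 (c _ Ux)).
have /nbhs_ballP[r /= r0 rU] : nbhs x (fun y => U y /\
    forall i, `|partial i f x - partial i f y| <= e').
  exact: filterI nU nP.
apply/nbhs_ballP; exists r => //= y xy.
pose z k : 'cV[R]_d := \col_i (if (i < k)%N then y i 0 else x i 0).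
have zd : z d = y by apply/colP => i; rewrite mxE ltn_ord.
have z0 : z 0%N = x by apply/colP => i; rewrite mxE.
(* Every coordinate of a point of the path is at most as far from that of [x] as the same coordinate
   of [y]; for the maximum norm this keeps the path in the ball. *)
have zU (k : 'I_d) c : `|c| <= `|y k 0 - x k 0| -> ball x r (c *: delta_mx k 0 + z k).
  move=> cy; rewrite -ball_normE/=; move: xy; rewrite -ball_normE/=.
  apply: le_lt_trans; rewrite distrC; apply: mx_norm_le => // i j.
  have xyi i' : `|y i' 0 - x i' 0| <= `|x - y|.
    by rewrite distrC; have := coord_le_mx_norm (x - y) i' 0; rewrite !mxE.
  rewrite (ord1 j) !mxE eqxx andbT; have [->|_] := eqVneq i k.
    by rewrite ltnn mulr1 addrK (le_trans cy).
  by case: ifP => _; rewrite mulr0 add0r ?subrr ?normr0.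
have -> : f y - f x = \sum_(i < d) (f (z i.+1) - f (z i)).
  by rewrite -[in LHS]zd -[in LHS]z0 -(telescope_sumr (f \o z) (leq0n d)) big_mkord.
rewrite -sumrB (le_trans (ler_norm_sum _ _ _))//.
have step (k : 'I_d) :
   `|f (z k.+1) - f (z k) - (y k 0 - x k 0) * partial k f x| <= e' * `|y - x|.
  have [c cy|c /zU/rU[_ /(_ k) H] E] := @MVT_line R _ f (z k) (delta_mx k 0) (y k 0 - x k 0).
    by apply: (f1 k).1; apply: (rU _ (zU _ _ cy)).1.
  rewrite (coord_interpolation x y k : z k.+1 = _) E -/(partial k f _).
  rewrite [X in _ - X]mulrC -mulrBl normrM distrC.
  rewrite ler_pM//.
  by have := coord_le_mx_norm (y - x) k 0; rewrite !mxE.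
rewrite (le_trans (ler_sum _ (fun k _ => step k)))// sumr_const card_ord.
rewrite -mulr_natl mulrA ler_wpM2r// /e' mulrCA ler_piMr// ?(ltW e0)//.
by rewrite ler_pdivrMr// mul1r ler_nat.
Qed.

(** * Closure properties of functions of class C^k *)

Section CkClosure.
Variables (R : realType) (d : nat).
Implicit Types (U : set 'cV[R]_d) (k : nat) (f g : 'cV[R]_d -> R).

Lemma Ck_onS (W : normedModType R) k U (f : 'cV[R]_d -> W) :
  Ck_on k.+1 U f -> Ck_on k U f.
Proof.
elim: k f => [|k IH] f; first by case.
by move=> [cf df]; split=> // i; have [? ?] := df i; split=> //; exact: IH.
Qed.

(** The formula for a partial derivative of a sum, a product or a power holds on [U] only; this
    transfer lets the inductions below work with the formula instead. Openness turns agreement on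
    [U] into agreement near each of its points. *)
Lemma Ck_on_eq (W : normedModType R) k U (f g : 'cV[R]_d -> W) :
  open U -> (forall x, U x -> f x = g x) -> Ck_on k U f -> Ck_on k U g.
Proof.
move=> oU; have nU x : U x -> \forall y \near x, U y.
  by move=> Ux; apply: open_nbhs_nbhs; split.
elim: k f g => [|k IH] f g fg [cf df].
all: have fgn x : U x -> \forall y \near x, f y = g y
  by move=> /nU; apply: filterS => y /fg.
all: have cg x (Ux : U x) : {for x, continuous g}
  by suff: g y @[y --> x] --> f x;
    [rewrite (fg x Ux)|apply: cvg_trans (cf _ Ux); exact: near_eq_cvg (fgn _ Ux)].
  by [].
split=> // i; have [dfi Cfi] := df i; split=> [x Ux|].
  by apply: near_eq_derivable (dfi _ Ux); exact: fgn.
by apply: IH Cfi => x Ux; apply: near_eq_derive; exact: fgn.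
Qed.

Lemma Ck_on_sub (W : normedModType R) k U V (f : 'cV[R]_d -> W) :
  V `<=` U -> Ck_on k U f -> Ck_on k V f.
Proof.
move=> VU; elim: k f => [|k IH] f [cf df]; split=> //; try by move=> x /VU/cf.
by move=> i; have [dfi Cfi] := df i; split; [move=> x /VU/dfi|exact: IH].
Qed.

Lemma Ck_on_cst k U (a : R) : open U -> Ck_on k U (fun=> a).
Proof.
move=> oU; elim: k a => [|k IH] a; first by split=> // x _; exact: cst_continuous.
split=> [x _|i]; first exact: cst_continuous.
split=> [x _|]; first exact: derivable_cst.
by apply: Ck_on_eq (IH 0) => // x _; rewrite /partial derive_cst.
Qed.

Lemma Ck_onD k U f g : open U ->
  Ck_on k U f -> Ck_on k U g -> Ck_on k U (fun x => f x + g x).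
Proof.
move=> oU; elim: k f g => [|k IH] f g [cf df] [cg dg].
all: have cfg x : U x -> {for x, continuous (fun x => f x + g x)}
  by move=> Ux; exact: continuousD (cf _ Ux) (cg _ Ux).
  by [].
split=> // i; have [dfi Cfi] := df i; have [dgi Cgi] := dg i.
split=> [x Ux|]; first by apply: derivableD; [exact: dfi|exact: dgi].
apply: Ck_on_eq (IH _ _ Cfi Cgi) => // x Ux.
by rewrite /partial deriveD; [|exact: dfi|exact: dgi].
Qed.

Lemma Ck_onM k U f g : open U ->
  Ck_on k U f -> Ck_on k U g -> Ck_on k U (fun x => f x * g x).
Proof.
move=> oU; elim: k f g => [|k IH] f g Cf Cg.
all: have cfg x : U x -> {for x, continuous (fun x => f x * g x)}
  by move=> Ux; exact: continuousM (Cf.1 _ Ux) (Cg.1 _ Ux).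
  by [].
split=> // i; have [dfi Cfi] := Cf.2 i; have [dgi Cgi] := Cg.2 i.
split=> [x Ux|]; first by apply: derivableM; [exact: dfi|exact: dgi].
apply: Ck_on_eq (Ck_onD oU (IH _ _ (Ck_onS Cf) Cgi) (IH _ _ (Ck_onS Cg) Cfi)).
  by [].
by move=> x Ux; rewrite /partial deriveM; [|exact: dfi|exact: dgi].
Qed.

(** Restricting to a line makes the one-variable chain rule available for directional
    derivatives. *)
Lemma is_derive_lineP (V W : normedModType R) (f : V -> W) (x u : V) (l : W) :
  is_derive x u f l <-> is_derive (0 : R) (1 : R) (fun s => f (s *: u + x)) l.
Proof.
have E : (fun h : R => h^-1 *: (f ((h *: (1 : R) + 0) *: u + x) -
                                f ((0 : R) *: u + x))) =
         (fun h : R => h^-1 *: (f (h *: u + x) - f x)).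
  by apply/funext => h; rewrite [h *: 1]mulr1 addr0 scale0r add0r.
by split=> -[]; rewrite /derivable /derive /= ?E => ? ?; split;
  rewrite /derivable /derive /= ?E.
Qed.

Lemma is_derive_comp (V : normedModType R) (f : V -> R) (h : R -> R)
    (x u : V) (l dh : R) :
  is_derive x u f l -> is_derive (f x) (1 : R) h dh ->
  is_derive x u (h \o f) (dh * l).
Proof.
move=> /is_derive_lineP fl dhf; apply/is_derive_lineP.
by apply: (@is_derive1_comp _ h); rewrite ?scale0r ?add0r.
Qed.

(** Differentiating an [a]-th power brings in the power [a - 1], so the induction on [k] keeps [a]
    arbitrary. Real powers treat inverses and square roots at once. *)
Lemma Ck_on_powR k U f (a : R) : open U -> (forall x, U x -> 0 < f x) ->
  Ck_on k U f -> Ck_on k U (fun x => f x `^ a).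
Proof.
move=> oU f0; elim: k a => [|k IH] a Cf.
all: have cfa x : U x -> {for x, continuous (fun x => f x `^ a)}
  by move=> Ux; apply: (@continuous_comp _ _ _ f (@powR R ^~ a));
    [exact: Cf.1|apply: differentiable_continuous; apply/derivable1_diffP;
     have [] := is_derive1_powR a (f0 _ Ux)].
  by [].
split=> // i; have [dfi Cfi] := Cf.2 i.
have D x (Ux : U x) : is_derive x (delta_mx i 0) (fun x => f x `^ a)
    (a * f x `^ (a - 1) * partial i f x).
  apply: (@is_derive_comp _ f (@powR R ^~ a)).
    by apply: derivableP; exact: dfi.
  exact: is_derive1_powR (f0 _ Ux).
split=> [x /D []//|].
have := Ck_onM oU (Ck_onM oU (Ck_on_cst k a oU) (IH (a - 1) (Ck_onS Cf))) Cfi.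
by apply: Ck_on_eq => // x Ux; have [_] := D x Ux; rewrite /partial => ->.
Qed.

Lemma Ck_on_mxP m n k U (M : 'cV[R]_d -> 'M[R]_(m, n)) : open U ->
  Ck_on k U M <-> forall i j, Ck_on k U (fun x => M x i j).
Proof.
move=> oU; elim: k M => [|k IH] M.
  split=> [[cM _] i j|CM]; split=> // x Ux.
    exact: (iffLR (cvg_mxP _ _ _) (cM x Ux)).
  by apply: (iffRL (cvg_mxP (nbhs_filter x) _ _)) => i j; exact: (CM i j).1.
split=> [[cM dM] i j|CM].
  split=> [x Ux|l]; first exact: (iffLR (cvg_mxP _ _ _) (cM x Ux)).
  have [dMl CMl] := dM l; split=> [x /dMl/derivable_mxP//|].
  apply: Ck_on_eq ((IH _).1 CMl i j) => // x Ux.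
  by rewrite /partial derive_mx ?mxE//; exact: dMl.
split=> [x Ux|l]; first by apply: (iffRL (cvg_mxP (nbhs_filter x) _ _)) => i j; exact: (CM i j).1.
have dM x : U x -> derivable M x (delta_mx l 0).
  by move=> Ux; apply/derivable_mxP => i j; exact: ((CM i j).2 l).1.
split=> //; apply/IH => i j.
apply: Ck_on_eq ((CM i j).2 l).2 => // x Ux.
by rewrite /partial derive_mx ?mxE//; exact: dM.
Qed.

End CkClosure.

(** For [c] an inverse time increment this is the chain rule along a curve, one-sided or not
    according to the filter. *)
Lemma C1_chain (R : realType) (d : nat) (U : set 'cV[R]_d) (f : 'cV[R]_d -> R)
    (x l : 'cV[R]_d) (T : Type) (F : set_system T) (FF : Filter F)
    (y : T -> 'cV[R]_d) (c : T -> R) :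
  open U -> U x -> Ck_on 1 U f -> y @ F --> x ->
  c t *: (y t - x) @[t --> F] --> l ->
  c t * (f (y t) - f x) @[t --> F] --> \sum_i l i 0 * partial i f x.
Proof.
move=> oU Ux Cf yx cl.
pose L t := \sum_i (c t *: (y t - x)) i 0 * partial i f x.
have LF : L t @[t --> F] --> \sum_i l i 0 * partial i f x.
  apply: cvg_big => [|i _]; [exact: add_continuous|apply: cvgMr_tmp].
  exact: (iffLR (cvg_mxP _ _ _) cl i 0).
pose e t := c t * (f (y t) - f x) - L t.
have -> : (fun t => c t * (f (y t) - f x)) = L \+ e.
  by apply/funext => t /=; rewrite /e [RHS]addrC subrK.
rewrite -[X in _ --> X]addr0; apply: cvgD => //.
(* [K] eventually bounds [c t *: (y t - x)], so an expansion error of [eps / K * |y t - x|] is at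
   most [eps] once multiplied by [c t]. *)
apply/cvgrPdist_le => eps eps0; pose K := `|l| + 1.
have K0 : 0 < K by rewrite ltr_wpDl.
have expn := C1_expansion oU Ux Cf (divr_gt0 eps0 K0).
near=> t; rewrite sub0r normrN.
have -> : e t = c t * (f (y t) - f x - \sum_i (y t i 0 - x i 0) * partial i f x).
  rewrite mulrBr mulr_sumr /e /L; congr (_ - _).
  by apply: eq_bigr => i _; rewrite !mxE mulrA.
have : `|c t *: (y t - x)| <= K.
  near: t; move/cvgrPdist_le: cl => /(_ 1 ltr01); apply: filterS => t.
  rewrite distrC => h; rewrite -[X in `|X|](subrK l) (le_trans (ler_normD _ _))//.
  by rewrite /K addrC lerD2l.
rewrite normrZ normrM => cK.
have h : `|f (y t) - f x - \sum_i (y t i 0 - x i 0) * partial i f x|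
    <= eps / K * `|y t - x|.
  by near: t; exact: (yx _ expn).
rewrite (le_trans (ler_wpM2l (normr_ge0 _) h))// mulrCA.
by rewrite (le_trans (ler_wpM2l _ cK)) ?divfK ?gt_eqF// divr_ge0// ltW.
Unshelve. all: by end_near. Qed.

(** * Derivatives relative to an interval *)

Section DeriveWithin.
Variable R : realType.
Implicit Types (I : set R) (t : R).

Lemma is_derive_within_cvg (W : normedModType R) I (f : R -> W) t l :
  is_derive_within I f t l -> f s @[s --> within I t^'] --> f t.
Proof.
move=> fl.
have : (s - t) *: ((s - t)^-1 *: (f s - f t)) + f t
    @[s --> within I t^'] --> (t - t) *: l + f t.
  apply: cvgD; last exact: cvg_cst.
  apply: (cvgZ _ fl); apply: cvgB; last exact: cvg_cst.
  by apply: cvg_trans (cvg_within _) _; exact: nbhs_dnbhs.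
rewrite subrr scale0r add0r; apply: cvg_trans; apply: near_eq_cvg.
near=> s; rewrite scalerA divff ?scale1r ?subrK// subr_eq0.
near: s; exact: (cvg_within I (nbhs_dnbhs_neq t)).
Unshelve. all: by end_near. Qed.

Lemma is_derive_within_comp d (U : set 'cV[R]_d) (f : 'cV[R]_d -> R) I q t l :
  open U -> U (q t) -> Ck_on 1 U f -> is_derive_within I q t l ->
  is_derive_within I (f \o q) t (\sum_i l i 0 * partial i f (q t)).
Proof.
move=> oU Ut Cf ql; apply: (C1_chain _ oU Ut Cf _ ql).
exact: is_derive_within_cvg ql.
Qed.

Lemma is_derive_within_mx m n I (M : R -> 'M[R]_(m, n)) t l i j :
  is_derive_within I M t l -> is_derive_within I (fun s => M s i j) t (l i j).
Proof.
move=> /(iffLR (cvg_mxP _ _ _))/(_ i j); apply: cvg_trans.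
by apply: near_eq_cvg; near=> s; rewrite !mxE.
Unshelve. all: by end_near. Qed.

Lemma is_derive_within_nbhs (W : normedModType R) I (f : R -> W) t l :
  nbhs t I -> is_derive_within I f t l -> is_derive t (1 : R) f l.
Proof.
move=> tI fl.
have lim : h^-1 *: (f (h *: (1 : R) + t) - f t) @[h --> 0^'] --> l.
  apply/cvgrPdist_le => e e0.
  have : nbhs t (fun s => s != t -> `|l - (s - t)^-1 *: (f s - f t)| <= e).
    apply: filterS2 tI ((cvgrPdist_le _ _).1 fl _ e0) => s Is H st.
    exact: (H st).
  move=> /nbhs_ballP[r /= r0 H]; apply/nbhs_ballP; exists r => //= h hr h0.
  have := H (h + t); rewrite addrK [h *: 1]mulr1; apply.
    by move: hr; rewrite -!ball_normE/= !sub0r !normrN opprD addrC addrNK normrN.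
  by rewrite -subr_eq0 addrK.
by split; [apply/cvg_ex; exists l|exact/cvg_lim].
Unshelve. all: by end_near. Qed.

Lemma is_derive_within_co (W : normedModType R) (a b : R) (f : R -> W) t l :
  a < t < b -> is_derive_within `[a, b[%classic f t l ->
  is_derive t (1 : R) f l.
Proof.
move=> atb; apply: is_derive_within_nbhs.
have : t \in `]a, b[ by rewrite in_itv.
move=> /near_in_itvoo; apply: filterS => s sI.
exact: subset_itv_oo_co sI.
Qed.

(** Right continuity at the left endpoint is what links the initial values to the derivatives known
    in the open interval. *)
Lemma is_derive_within_right (W : normedModType R) (a b : R) (f : R -> W) l :
  a < b -> is_derive_within `[a, b[%classic f a l ->
  f s @[s --> a^'+] --> f a.
Proof.
move=> ab /is_derive_within_cvg; apply: cvg_trans; apply: cvg_app.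
move=> P /= Pa; have sb : nbhs a (fun s => s < b) by exact: lt_nbhsl.
suff : nbhs a (fun s => a < s -> P s) by [].
have {}Pa : nbhs a (fun s => s != a -> `[a, b[%classic s -> P s) by [].
apply: filterS2 sb Pa => s sb Ps as_.
by apply: Ps; rewrite ?gt_eqF//= in_itv/= (ltW as_).
Qed.

Lemma constant_on_co (a b : R) (f : R -> R) : 
  f s @[s --> a^'+] --> f a ->
  (forall t, a < t < b -> is_derive t (1 : R) f 0) ->
  forall t, a <= t < b -> f t = f a.
Proof.
move=> fa df t /andP[]; rewrite le_eqVlt => /predU1P[->//|at_ tb].
have dfat s : a < s <= t -> is_derive s (1 : R) f 0.
  by move=> /andP[as_ st]; apply: df; rewrite as_ (le_lt_trans st).
have cf s : a < s <= t -> {for s, continuous f}.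
  by move=> /dfat [ds _]; apply/differentiable_continuous/derivable1_diffP.
have [s /itvP sI||c _] := @MVT R f (cst 0) a t at_.
- by apply: dfat; rewrite !sI.
- apply/continuous_within_itvP => //; split=> //.
    by move=> s; rewrite in_itv/= => /andP[as_ st]; apply: cf; rewrite as_ ltW.
  by apply: cvg_at_left_filter; apply: cf; rewrite at_ lexx.
- by rewrite mul0r => /eqP; rewrite subr_eq0 => /eqP.
Qed.

End DeriveWithin.

(** * Transport in the kernel of a moving rank-one projector *)

Section ParallelTransport.
Variables (R : realType) (t0 t1 : R).
Variables (a b y0 y1 a' b' : R -> R).

(* [a, b; b, 1 - a] is a moving rank-one orthogonal projector P with derivative
   D = [a', b'; b', - a'], and y moves by y' = - P D (y - P y) with x = y - P y. *)
Let x0 t := y0 t - (a t * y0 t + b t * y1 t).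
Let x1 t := y1 t - (b t * y0 t + (1 - a t) * y1 t).
Let m0 t := a' t * x0 t + b' t * x1 t.
Let m1 t := b' t * x0 t - a' t * x1 t.

Hypothesis t01 : t0 < t1.
Hypothesis ab_idem : forall t, t0 <= t < t1 -> a t ^+ 2 + b t ^+ 2 = a t.
Hypothesis a_right : a s @[s --> t0^'+] --> a t0.
Hypothesis b_right : b s @[s --> t0^'+] --> b t0.
Hypothesis y0_right : y0 s @[s --> t0^'+] --> y0 t0.
Hypothesis y1_right : y1 s @[s --> t0^'+] --> y1 t0.
Hypothesis da : forall t, t0 < t < t1 -> is_derive t (1 : R) a (a' t).
Hypothesis db : forall t, t0 < t < t1 -> is_derive t (1 : R) b (b' t).
Hypothesis dy0 : forall t, t0 < t < t1 ->
  is_derive t (1 : R) y0 (- (a t * m0 t + b t * m1 t)).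
Hypothesis dy1 : forall t, t0 < t < t1 ->
  is_derive t (1 : R) y1 (- (b t * m0 t + (1 - a t) * m1 t)).
Hypothesis z0_init : a t0 * y0 t0 + b t0 * y1 t0 = 0.
Hypothesis z1_init : b t0 * y0 t0 + (1 - a t0) * y1 t0 = 0.

(** An identity valid modulo a relation [e = 0] is certified by its cofactor [c]: [ring] then checks
    [x = c * e]. *)
Let eq0_mul (c e x : R) : e = 0 -> x = c * e -> x = 0.
Proof. by move=> -> ->; rewrite mulr0. Qed.

Let is_derive_mul (f g : R -> R) (t df dg : R) :
  is_derive t (1 : R) f df -> is_derive t (1 : R) g dg ->
  is_derive t (1 : R) (fun s => f s * g s) (f t * dg + g t * df).
Proof. by move=> hf hg; apply: (is_deriveM hf hg). Qed.

Let is_derive_add (f g : R -> R) (t df dg : R) :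
  is_derive t (1 : R) f df -> is_derive t (1 : R) g dg ->
  is_derive t (1 : R) (fun s => f s + g s) (df + dg).
Proof. by move=> hf hg; apply: (is_deriveD hf hg). Qed.

Let is_derive_sub (f g : R -> R) (t df dg : R) :
  is_derive t (1 : R) f df -> is_derive t (1 : R) g dg ->
  is_derive t (1 : R) (fun s => f s - g s) (df - dg).
Proof. by move=> hf hg; apply: (is_deriveB hf hg). Qed.

(** Derivative of [a ^+ 2 + b ^+ 2 = a]. It says that tr(P D) = 0, which for a rank-one P is the
    relation P D P = 0. *)
Let ab_idem' t : t0 < t < t1 -> 2 * (a t * a' t + b t * b' t) = a' t.
Proof.
move=> tI.
have D := is_derive_sub (is_derive_add (is_derive_mul (da tI) (da tI))
                                       (is_derive_mul (db tI) (db tI))) (da tI).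
have : is_derive t (1 : R) (cst 0) (a t * a' t + a t * a' t +
    (b t * b' t + b t * b' t) - a' t).
  apply: near_eq_is_derive D.
  have : t \in `]t0, t1[ by rewrite in_itv.
  move=> /near_in_itvoo; apply: filterS => s; rewrite in_itv/= => /andP[ts st].
  by rewrite -!expr2 ab_idem ?subrr// (ltW ts).
case=> _; rewrite derive_cst => E.
by apply/eqP; rewrite -subr_eq0 [X in _ == X]E; apply/eqP; ring.
Qed.

(** The quadratic form <y, P y> = |P y|^2, expanded without squares or a factor 2 so that it matches
    literally the function differentiated by the product rule. *)
Let N t := a t * (y0 t * y0 t) + (b t * (y0 t * y1 t) + b t * (y0 t * y1 t)) +
  (1 - a t) * (y1 t * y1 t).

(** Since P has rank one, (P y)(P y)^T = N P; these are its entries. In particular P y vanishes as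
    soon as [N] does. *)
Let N_sqr t : t0 <= t < t1 ->
  [/\ (a t * y0 t + b t * y1 t) ^+ 2 = a t * N t,
      (a t * y0 t + b t * y1 t) * (b t * y0 t + (1 - a t) * y1 t) = b t * N t &
      (b t * y0 t + (1 - a t) * y1 t) ^+ 2 = (1 - a t) * N t].
Proof.
move=> /ab_idem E; rewrite /N.
have {}E : a t - a t ^+ 2 - b t ^+ 2 = 0 by rewrite -[X in X - _ - _]E; ring.
split; apply/subr0_eq.
- by apply: (eq0_mul (c := - y1 t ^+ 2) E); ring.
- by apply: (eq0_mul (c := y0 t * y1 t) E); ring.
- by apply: (eq0_mul (c := - y0 t ^+ 2) E); ring.
Qed.

(** With z = P y, N' = <y, D y> + 2 <z, y'> = 2 <z, D y> - 2 <z, D (y - z)> = 2 <z, D z> = 0. *)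
Let dN t : t0 < t < t1 -> is_derive t (1 : R) N 0.
Proof.
move=> tI; have E2 := ab_idem' tI.
have [sq0 sq01 sq1] : [/\ (a t * y0 t + b t * y1 t) ^+ 2 = a t * N t,
      (a t * y0 t + b t * y1 t) * (b t * y0 t + (1 - a t) * y1 t) = b t * N t &
      (b t * y0 t + (1 - a t) * y1 t) ^+ 2 = (1 - a t) * N t].
  by apply: N_sqr; case/andP: tI => /ltW -> ->.
have E1 : a t - a t ^+ 2 - b t ^+ 2 = 0.
  by case/andP: tI => /ltW h1 h2; rewrite -[X in X - _ - _]ab_idem ?h1//; ring.
have D00 := is_derive_mul (dy0 tI) (dy0 tI).
have D01 := is_derive_mul (dy0 tI) (dy1 tI).
have D11 := is_derive_mul (dy1 tI) (dy1 tI).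
have Db := is_derive_mul (db tI) D01.
have Dc := is_derive_mul (is_derive_sub (is_derive_cst (1 : R) t (1 : R)) (da tI)) D11.
have D := is_derive_add (is_derive_add (is_derive_mul (da tI) D00) (is_derive_add Db Db)) Dc.
apply: (@is_derive_eq _ _ _ N _ _ _ _ D) => /=; move: E2 E1 sq0 sq01 sq1.
rewrite /m0 /m1 /x0 /x1.
set A := a t; set B := b t; set A' := a' t; set B' := b' t.
set p := y0 t; set q := y1 t; set n := N t => E2 E1 sq0 sq01 sq1.
have E2' : 2 * (A * A' + B * B') - A' = 0 by rewrite E2 subrr.
pose z := A * p + B * q; pose z' := B * p + (1 - A) * q.
(* <z, D z> = N tr(P D), because z z^T = N P. *)
have zDz : A' * (z ^+ 2 - z' ^+ 2) + 2 * B' * (z * z') = 0.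
  by rewrite sq0 sq1 sq01; apply: (eq0_mul (c := n) E2'); ring.
(* P D + D P - D = tr(P D) Id, whence 2 <P y, D y> = <y, D y>; the cofactor is |y|^2. *)
have YDY : 2 * (z * (A' * p + B' * q) + z' * (B' * p - A' * q)) =
   A' * p ^+ 2 + 2 * B' * (p * q) - A' * q ^+ 2.
  apply/subr0_eq.
  by rewrite /z /z'; apply: (eq0_mul (c := p ^+ 2 + q ^+ 2) E2'); ring.
have Pz : A * z + B * z' = z.
  by apply/subr0_eq; rewrite /z /z'; apply: (eq0_mul (c := - p) E1); ring.
have Pz' : B * z + (1 - A) * z' = z'.
  by apply/subr0_eq; rewrite /z /z'; apply: (eq0_mul (c := - q) E1); ring.
rewrite -/z -/z'.
(* (u, u') is D (y - z), so y' is - P (u, u'), and P z = z removes this P from the inner product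
   with z. *)
pose u := A' * (p - z) + B' * (q - z'); pose u' := B' * (p - z) - A' * (q - z').
rewrite -/u -/u'.
transitivity (A' * p ^+ 2 + 2 * B' * (p * q) - A' * q ^+ 2 - 2 * (z * u + z' * u')); last first.
  by rewrite -YDY /u /u'; apply: (eq0_mul (c := 2) zDz); ring.
have -> : z * u + z' * u' = (A * z + B * z') * u + (B * z + (1 - A) * z') * u'.
  by rewrite Pz Pz'.
by move: u u' => u u'; rewrite /z /z'; ring.
Qed.

Lemma parallel_transport t : t0 <= t < t1 ->
  [/\ a t * y0 t + b t * y1 t = 0, b t * y0 t + (1 - a t) * y1 t = 0 &
      y0 t ^+ 2 + y1 t ^+ 2 = y0 t0 ^+ 2 + y1 t0 ^+ 2].
Proof.
have z_eq0 s : t0 <= s < t1 ->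
    a s * y0 s + b s * y1 s = 0 /\ b s * y0 s + (1 - a s) * y1 s = 0.
  move=> sI; have [sq0 _ sq1] := N_sqr sI.
  have N0 : N s = 0.
    rewrite (constant_on_co _ dN sI).
      rewrite /N (_ : _ + _ = y0 t0 * (a t0 * y0 t0 + b t0 * y1 t0) +
        y1 t0 * (b t0 * y0 t0 + (1 - a t0) * y1 t0)); last by ring.
      by rewrite z0_init z1_init !mulr0 addr0.
    apply: cvgD; [apply: cvgD; [|apply: cvgD]|].
    - by apply: cvgM => //; exact: cvgM.
    - by apply: cvgM => //; exact: cvgM.
    - by apply: cvgM => //; exact: cvgM.
    - apply: cvgM; last exact: cvgM.
      by apply: cvgB => //; exact: cvg_cst.
  by move: sq0 sq1; rewrite N0 !mulr0 => /eqP + /eqP; rewrite !sqrf_eq0 => /eqP + /eqP.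
move=> tI; have [-> ->] := z_eq0 _ tI; split=> //; rewrite !expr2.
apply: (@constant_on_co _ t0 t1 (fun s => y0 s * y0 s + y1 s * y1 s)) tI.
  by apply: cvgD; exact: cvgM.
move=> s sI; have D := is_derive_add (is_derive_mul (dy0 sI) (dy0 sI))
  (is_derive_mul (dy1 sI) (dy1 sI)).
apply: (is_derive_eq D).
have [|Z0 Z1] := z_eq0 s; first by case/andP: sI => /ltW -> ->.
transitivity (- 2 * (m0 s * (a s * y0 s + b s * y1 s) +
  m1 s * (b s * y0 s + (1 - a s) * y1 s))); first by ring.
by rewrite Z0 Z1 !mulr0 addr0 mulr0.
Qed.

End ParallelTransport.

(** * Plane vectors and the eigenvectors of A(omega) *)

Section Plane.
Variable R : realType.
Implicit Types (u V : 'cV[R]_2).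

Lemma sum_ord2 (W : nmodType) (F : 'I_2 -> W) : \sum_i F i = F 0 + F 1.
Proof.
by rewrite !big_ord_recl big_ord0 addr0; congr (_ + F _); apply: val_inj.
Qed.

Lemma ord2P (P : 'I_2 -> Prop) : P 0 -> P 1 -> forall i, P i.
Proof.
by move=> P0 P1 [[|[|//]] i2];
  [rewrite (_ : Ordinal i2 = 0)|rewrite (_ : Ordinal i2 = 1)]; rewrite //; apply: val_inj.
Qed.

Lemma enorm2_sqr u : enorm u ^+ 2 = u 0 0 ^+ 2 + u 1 0 ^+ 2.
Proof. by rewrite /enorm sum_ord2 sqr_sqrtr// addr_ge0// sqr_ge0. Qed.

Lemma enorm_ge0 u : 0 <= enorm u.
Proof. exact: sqrtr_ge0. Qed.

Lemma enorm_gt0 u : u <> 0 -> 0 < enorm u.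
Proof.
move=> u0; rewrite lt0r enorm_ge0 andbT; apply/eqP => E; apply: u0.
have /eqP := enorm2_sqr u; rewrite E expr0n/= eq_sym paddr_eq0 ?sqr_ge0//.
rewrite !sqrf_eq0 => /andP[/eqP u00 /eqP u10].
by apply/colP; apply: ord2P; rewrite mxE.
Qed.

Lemma AmxE u : [/\ Amx u 0 0 = u 0 0, Amx u 0 1 = u 1 0, Amx u 1 0 = u 1 0 &
  Amx u 1 1 = - u 0 0].
Proof. by rewrite !mxE. Qed.

Lemma mulmx2E (M : 'M[R]_2) (y : 'cV[R]_2) i :
  (M *m y) i 0 = M i 0 * y 0 0 + M i 1 * y 1 0.
Proof. by rewrite mxE sum_ord2. Qed.

(* With omega = (cos h, sin h) V = (cos (h / 2), sin (h / 2)) up to sign. *)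
Lemma Amx_eigenvector omega : enorm omega = 1 ->
  exists V, enorm V = 1 /\ Amx omega *m V = V.
Proof.
move=> om1; set c := omega 0 0; set s := omega 1 0.
have cs : s ^+ 2 = 1 - c ^+ 2.
  by have := enorm2_sqr omega; rewrite om1 expr1n => ->; rewrite addrC addKr.
have mk x y : x ^+ 2 + y ^+ 2 = 1 -> c * x + s * y = x -> s * x - c * y = y ->
    exists V, enorm V = 1 /\ Amx omega *m V = V.
  move=> xy1 Ex Ey; exists (\col_i (if i == 0 then x else y)); split.
    by rewrite /enorm sum_ord2 !mxE/= xy1 sqrtr1.
  have [A00 A01 A10 A11] := AmxE omega.
  by apply/colP; apply: ord2P; rewrite mulmx2E ?A00 ?A01 ?A10 ?A11 !mxE/= ?mulNr.
(* The half-angle formula degenerates at omega = (-1, 0), where (0, 1) is an eigenvector. *)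
have [c1|c1] := eqVneq (1 + c) 0.
  have cE : c = -1 by apply/eqP; rewrite -addr_eq0 addrC c1.
  have s0 : s = 0 by apply/eqP; rewrite -sqrf_eq0 cs cE sqrrN expr1n subrr.
  by apply: (mk 0 1); rewrite ?s0 ?cE; ring.
have c0 : 0 < 1 + c.
  rewrite lt0r c1/=; have : c ^+ 2 <= 1 by rewrite -subr_ge0 -cs sqr_ge0.
  by nra.
(* (1 + c, s) = 2 cos (h / 2) (cos (h / 2), sin (h / 2)), and [n] is its norm. *)
set n := Num.sqrt (2 * (1 + c)).
have nE : n ^+ 2 = 2 * (1 + c) by rewrite sqr_sqrtr// mulr_ge0// ltW.
have n0 : n != 0 by rewrite -sqrf_eq0 nE mulf_neq0.
apply: (mk ((1 + c) / n) (s / n)).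
- by rewrite !expr_div_n nE cs; field.
- by rewrite !mulrA -mulrDl -expr2 cs; congr (_ / n); ring.
- by rewrite !mulrA -mulrBl; congr (_ / n); ring.
Qed.

End Plane.

(** * Smoothness of the spectral projectors off the crossing set *)

Section Smoothness.
Variables (R : realType) (d : nat).
Implicit Types (U : set 'cV[R]_d) (w : 'cV[R]_d -> 'cV[R]_2).

Lemma open_off_Upsilon w : (forall x, {for x, continuous w}) ->
  open [set x | w x <> 0].
Proof.
move=> cw; have -> : [set x | w x <> 0] = w @^-1` (~` [set 0]) by [].
apply: open_comp => [x _|]; first exact: cw.
by apply: closed_openC; apply: accessible_closed_set1; exact/hausdorff_accessible/norm_hausdorff.
Qed.

(** The squared norm is polynomial in [w] and positive on [U]; its power [a / 2] is the required
    function. *)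
Lemma Ck_on_enorm_powR k U w (a : R) : open U -> (forall x, U x -> w x <> 0) ->
  Ck_on k U w -> Ck_on k U (fun x => enorm (w x) `^ a).
Proof.
move=> oU w0 Cw.
have Cwi i : Ck_on k U (fun x => w x i 0) by exact: ((Ck_on_mxP k w oU).1 Cw i 0).
pose n x := w x 0 0 * w x 0 0 + w x 1 0 * w x 1 0.
have nE x : n x = enorm (w x) ^+ 2 by rewrite enorm2_sqr !expr2.
have n0 x : U x -> 0 < n x by move=> Ux; rewrite nE; apply/exprn_gt0/enorm_gt0/w0.
have Cn : Ck_on k U n by apply: Ck_onD oU (Ck_onM oU _ _) (Ck_onM oU _ _); exact: Cwi.
apply: Ck_on_eq (Ck_on_powR (2^-1 * a) oU n0 Cn) => // x Ux.
by rewrite powRrM powR12_sqrt ?ltW ?n0// nE sqrtr_sqr ger0_norm// enorm_ge0.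
Qed.

Lemma PiE w e x i j : Pi w e x i j =
  2^-1 * ((i == j)%:R + e * ((enorm (w x))^-1 * Amx (w x) i j)).
Proof. by rewrite !mxE. Qed.

Lemma Ck_on_Amx k U w i j : open U -> Ck_on k U w ->
  Ck_on k U (fun x => Amx (w x) i j).
Proof.
move=> oU /(Ck_on_mxP _ _ oU) Cw; rewrite /Amx.
have CN : Ck_on k U (fun x => - w x 0 0).
  apply: Ck_on_eq (Ck_onM oU (Ck_on_cst k (-1) oU) (Cw 0 0)) => // x _.
  by rewrite mulN1r.
apply: (@Ck_on_eq _ _ _ k U (fun x => if i == 0 then (if j == 0 then w x 0 0 else w x 1 0)
                 else (if j == 0 then w x 1 0 else - w x 0 0))) => //.
  by move=> x _; rewrite [RHS]mxE.
by case: (i == 0); case: (j == 0).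
Qed.

Lemma Ck_on_Pi k U w e : open U -> (forall x, U x -> w x <> 0) ->
  Ck_on k U w -> Ck_on k U (Pi w e).
Proof.
move=> oU w0 Cw; apply/(Ck_on_mxP _ _ oU) => i j.
have C := Ck_onM oU (Ck_on_cst k 2^-1 oU) (Ck_onD oU (Ck_on_cst k (i == j)%:R oU)
  (Ck_onM oU (Ck_on_cst k e oU) (Ck_onM oU (Ck_on_enorm_powR (-1) oU w0 Cw)
  (Ck_on_Amx i j oU Cw)))).
apply: Ck_on_eq C => // x Ux.
by rewrite PiE powR_inv1// enorm_ge0.
Qed.

Lemma directional_mxE m n k U (M : 'cV[R]_d -> 'M[R]_(m, n)) x (p : 'cV[R]_d) i j :
  Ck_on k.+1 U M -> U x ->
  (\sum_l p l 0 *: partial l M x) i j =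
  \sum_l p l 0 * partial l (fun y => M y i j) x.
Proof.
move=> [_ CM] Ux; rewrite summxE; apply: eq_bigr => l _.
by rewrite mxE /partial derive_mx ?mxE//; exact: (CM l).1.
Qed.

End Smoothness.

(** * A smooth unit eigenvector field *)

Section EigenvectorField.
Variables (R : realType) (d : nat) (w : 'cV[R]_d -> 'cV[R]_2).
Implicit Types (x : 'cV[R]_d) (y e V : 'cV[R]_2).

(** Puts Pi_+ in the form [a, b; b, 1 - a] on which the transport argument operates; the last
    relation is idempotence. *)
Lemma Pi1_idem x : w x <> 0 ->
  [/\ Pi w 1 x 1 0 = Pi w 1 x 0 1, Pi w 1 x 1 1 = 1 - Pi w 1 x 0 0 &
      Pi w 1 x 0 0 ^+ 2 + Pi w 1 x 0 1 ^+ 2 = Pi w 1 x 0 0].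
Proof.
move=> /enorm_gt0; have := enorm2_sqr (w x); have [A00 A01 A10 A11] := AmxE (w x).
rewrite !PiE A00 A01 A10 A11 !mul1r/= => E /lt0r_neq0 n0; split=> //.
  by field.
have w1 : w x 1 0 ^+ 2 = enorm (w x) ^+ 2 - w x 0 0 ^+ 2 by rewrite E addrC addKr.
by rewrite add0r 3!exprMn w1; field.
Qed.

Lemma PiN1_coordE x i j : Pi w (-1) x i j = (i == j)%:R - Pi w 1 x i j.
Proof. by rewrite !PiE; move: ((enorm _)^-1 * _) ((i == j)%:R) => u c; field. Qed.

Lemma PiN1E x : Pi w (-1) x = 1%:M - Pi w 1 x.
Proof.
apply/matrixP => i j; rewrite PiN1_coordE.
by have -> (M : 'M[R]_2) : (1%:M - M) i j = (i == j)%:R - M i j by rewrite !mxE.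
Qed.

(** Since Pi_- = 1 - Pi_+, a vector is fixed by Pi_- exactly when Pi_+ kills it. *)
Lemma PiN1_fixE x y : w x <> 0 -> Pi w (-1) x *m y = y <->
  Pi w 1 x 0 0 * y 0 0 + Pi w 1 x 0 1 * y 1 0 = 0 /\
  Pi w 1 x 0 1 * y 0 0 + (1 - Pi w 1 x 0 0) * y 1 0 = 0.
Proof.
move=> w0; have [P10 P11 _] := Pi1_idem w0; rewrite PiN1E mulmxBl mul1mx.
have fixE : (y - Pi w 1 x *m y == y) = (Pi w 1 x *m y == 0).
  by rewrite subr_eq addrC -subr_eq subrr eq_sym.
split=> [/eqP|[z0 z1]].
  rewrite fixE => /eqP /colP z; have := z 0; have := z 1.
  by rewrite !mulmx2E P10 P11 !mxE.
apply/eqP; rewrite fixE; apply/eqP/colP.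
by apply: ord2P; rewrite mulmx2E ?P10 ?P11 ?z0 ?z1 mxE.
Qed.

(* The range of Pi_- is a line, so a unit vector in it is determined up to sign. *)
Lemma PiN1_unit_colinear x y e : w x <> 0 ->
  enorm y = 1 -> enorm e = 1 -> Pi w (-1) x *m y = y -> Pi w (-1) x *m e = e ->
  let s := y 0 0 * e 0 0 + y 1 0 * e 1 0 in y = s *: e /\ s ^+ 2 = 1.
Proof.
move=> w0 y1 e1 /(PiN1_fixE _ w0)[Y0 Y1] /(PiN1_fixE _ w0)[E0 E1] s.
set a := Pi w 1 x 0 0 in Y0 Y1 E0 E1; set b := Pi w 1 x 0 1 in Y0 Y1 E0 E1.
(* tr(P) det(y, e) = det(P y, e) + det(y, P e), where P = Pi_+ has trace 1 and kills both
   vectors. *)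
have det0 : y 0 0 * e 1 0 - y 1 0 * e 0 0 = 0.
  transitivity ((a * y 0 0 + b * y 1 0) * e 1 0 - (a * e 0 0 + b * e 1 0) * y 1 0 +
    ((b * e 0 0 + (1 - a) * e 1 0) * y 0 0 - (b * y 0 0 + (1 - a) * y 1 0) * e 0 0)).
    by ring.
  by rewrite Y0 Y1 E0 E1 !mul0r !subrr addr0.
have := enorm2_sqr y; have := enorm2_sqr e; rewrite y1 e1 expr1n => en yn.
split.
  apply/colP; apply: ord2P; rewrite mxE; apply/subr0_eq.
    transitivity (y 0 0 * (1 - (e 0 0 ^+ 2 + e 1 0 ^+ 2)) +
      e 1 0 * (y 0 0 * e 1 0 - y 1 0 * e 0 0)); first by rewrite /s; ring.
    by rewrite det0 -en subrr !mulr0 addr0.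
  transitivity (y 1 0 * (1 - (e 0 0 ^+ 2 + e 1 0 ^+ 2)) -
    e 0 0 * (y 0 0 * e 1 0 - y 1 0 * e 0 0)); first by rewrite /s; ring.
  by rewrite det0 -en subrr !mulr0 subr0.
(* Lagrange's identity: <y, e>^2 + det(y, e)^2 = |y|^2 |e|^2. *)
transitivity ((y 0 0 ^+ 2 + y 1 0 ^+ 2) * (e 0 0 ^+ 2 + e 1 0 ^+ 2) -
  (y 0 0 * e 1 0 - y 1 0 * e 0 0) ^+ 2); first by rewrite /s; ring.
by rewrite det0 -en -yn mulr1 expr0n/= subr0.
Qed.

(** <V, Pi_- V>, which off [Upsilon] is |Pi_- V|^2; hence the exponent -1/2 in the normalization
    below. *)
Definition overlap V x : R :=
  V 0 0 * (Pi w (-1) x *m V) 0 0 + V 1 0 * (Pi w (-1) x *m V) 1 0.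

Definition unit_projection V x : 'cV[R]_2 :=
  (overlap V x) `^ (- 2^-1) *: (Pi w (-1) x *m V).

Lemma unit_projectionP V x : w x <> 0 -> 0 < overlap V x ->
  Pi w (-1) x *m unit_projection V x = unit_projection V x /\
  enorm (unit_projection V x) = 1.
Proof.
move=> w0 k0; have [P10 P11 E] := Pi1_idem w0.
set a := Pi w 1 x 0 0 in P11 E *; set b := Pi w 1 x 0 1 in P10 E *.
have E' : a - a ^+ 2 - b ^+ 2 = 0 by rewrite -[X in X - _ - _]E; ring.
have pE : (Pi w (-1) x *m V) 0 0 = (1 - a) * V 0 0 - b * V 1 0 /\
          (Pi w (-1) x *m V) 1 0 = a * V 1 0 - b * V 0 0.
  by rewrite !mulmx2E !PiN1_coordE P10 P11 -/a -/b /=; split; ring.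
have kE : overlap V x = (Pi w (-1) x *m V) 0 0 ^+ 2 + (Pi w (-1) x *m V) 1 0 ^+ 2.
  rewrite /overlap pE.1 pE.2; apply/subr0_eq.
  transitivity ((V 0 0 ^+ 2 + V 1 0 ^+ 2) * (a - a ^+ 2 - b ^+ 2)); first by ring.
  by rewrite E' mulr0.
split.
  rewrite -scalemxAr; congr (_ *: _); apply/PiN1_fixE => //; rewrite pE.1 pE.2 -/a -/b.
  split.
    transitivity (V 0 0 * (a - a ^+ 2 - b ^+ 2)); first by ring.
    by rewrite E' mulr0.
  transitivity (V 1 0 * (a - a ^+ 2 - b ^+ 2)); first by ring.
  by rewrite E' mulr0.
have kk : (overlap V x `^ (- 2^-1)) ^+ 2 * overlap V x = 1.
  rewrite -powR_mulrn ?powR_ge0// -powRrM mulNr mulVf// powR_inv1 ?ltW//.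
  by rewrite mulVf// gt_eqF.
rewrite /enorm sum_ord2 !(mxE scalemx_key) !exprMn -mulrDr -kE kk.
exact: sqrtr1.
Qed.

Lemma Ck_on_mulPiV n U V i : open U -> (forall x, U x -> w x <> 0) ->
  Ck_on n U w -> Ck_on n U (fun x => (Pi w (-1) x *m V) i 0).
Proof.
move=> oU w0 Cw.
have CP j : Ck_on n U (fun x => Pi w (-1) x i j).
  exact: ((Ck_on_mxP n _ oU).1 (Ck_on_Pi (-1) oU w0 Cw) i j).
have C := Ck_onD oU (Ck_onM oU (CP 0) (Ck_on_cst n (V 0 0) oU))
                    (Ck_onM oU (CP 1) (Ck_on_cst n (V 1 0) oU)).
by apply: Ck_on_eq C => // x _; rewrite mulmx2E.
Qed.

Lemma Ck_on_overlap n U V : open U -> (forall x, U x -> w x <> 0) ->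
  Ck_on n U w -> Ck_on n U (overlap V).
Proof.
move=> oU w0 Cw.
have C i : Ck_on n U (fun x => V i 0 * (Pi w (-1) x *m V) i 0).
  exact: Ck_onM oU (Ck_on_cst n _ oU) (Ck_on_mulPiV V i oU w0 Cw).
exact: Ck_onD oU (C 0) (C 1).
Qed.

Lemma smooth_unit_projection U V : open U ->
  (forall x, U x -> w x <> 0 /\ 0 < overlap V x) ->
  smooth_on U w -> smooth_on U (unit_projection V).
Proof.
move=> oU Uk Cw n; have w0 x : U x -> w x <> 0 by move=> /Uk[].
apply/(Ck_on_mxP _ _ oU) => i j; rewrite (ord1 j).
have k0 x : U x -> 0 < overlap V x by move=> /Uk[].
have C := Ck_onM oU (Ck_on_powR (- 2^-1) oU k0 (Ck_on_overlap V oU w0 (Cw n)))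
  (Ck_on_mulPiV V i oU w0 (Cw n)).
by apply: Ck_on_eq C => // x _; rewrite [RHS](mxE scalemx_key).
Qed.

Lemma open_unit_projection_dom V : smooth_on setT w ->
  open [set x | w x <> 0 /\ 0 < overlap V x].
Proof.
move=> Cw; pose Z := [set x | w x <> 0].
have oZ : open Z by apply: open_off_Upsilon => x; exact: (Cw 0%N).1.
have Ck : Ck_on 0 Z (overlap V).
  by apply: Ck_on_overlap => //; apply: Ck_on_sub (Cw 0%N) => x.
rewrite openE => x [w0 k0]; rewrite /interior.
have nZ : nbhs x Z by apply: open_nbhs_nbhs; split.
have nk : nbhs x (fun x' => 0 < overlap V x') by apply: cvgr_gt (Ck.1 x w0) _ k0.
by apply: filterS2 nZ nk => y.
Qed.

(** If Pi_- tends along [y] to a matrix fixing [V], then Pi_- V tends to [V] and its squared norm to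
    1. The limit is taken along [y] because the points may approach [Upsilon], where the field
    itself has no continuity to offer. *)
Lemma unit_projection_cvg (T : Type) (F : set_system T) (FF : Filter F)
    (y : T -> 'cV[R]_d) V (Q : 'M[R]_2) :
  enorm V = 1 -> Q *m V = V ->
  (forall i j, Pi w (-1) (y t) i j @[t --> F] --> Q i j) ->
  overlap V (y t) @[t --> F] --> (1 : R) /\ unit_projection V (y t) @[t --> F] --> V.
Proof.
move=> V1 QV PQ.
have PV i : (Pi w (-1) (y t) *m V) i 0 @[t --> F] --> V i 0.
  rewrite -[in X in _ --> X]QV mulmx2E.
  under eq_cvg do rewrite mulmx2E.
  by apply: cvgD; apply: cvgMr_tmp; exact: PQ.
have kF : overlap V (y t) @[t --> F] --> (1 : R).
  rewrite -(expr1n _ 2) -V1 enorm2_sqr.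
  by apply: cvgD; apply: cvgMl_tmp; exact: PV.
split=> //; apply/cvg_mxP => i j; rewrite (ord1 j).
have kpow : overlap V (y t) `^ (- 2^-1) @[t --> F] --> (1 : R).
  have : {for (1 : R), continuous (@powR R ^~ (- 2^-1))}.
    apply: differentiable_continuous; apply/derivable1_diffP.
    by have [] := is_derive1_powR (- 2^-1) (ltr01 : 0 < (1 : R)).
  by rewrite /prop_for /continuous_at powR1 => P1; exact: (cvg_comp _ _ kF P1).
have -> : (fun t => unit_projection V (y t) i 0) =
    (fun t => overlap V (y t) `^ (- 2^-1) * (Pi w (-1) (y t) *m V) i 0).
  by apply/funext => t; rewrite (mxE scalemx_key).
rewrite -[X in _ --> X]mul1r; exact: cvgM kpow (PV i).
Qed.

End EigenvectorField.

(** * Limit of the projector along the trajectory *)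

Section Trajectory.
Variables (R : realType) (d : nat) (w : 'cV[R]_d -> 'cV[R]_2).
Variables (t0 t1 : R) (q p : R -> 'cV[R]_d).
Hypothesis w_smooth : smooth_on setT w.
Hypothesis t01 : t0 < t1.
Hypothesis dq : forall t, t0 <= t < t1 -> is_derive_within `[t0, t1[%classic q t (p t).

Let dwq i t : t0 < t < t1 -> is_derive t (1 : R) (fun s => w (q s) i 0)
  (\sum_l p t l 0 * partial l (fun x => w x i 0) (q t)).
Proof.
move=> tI; apply: (is_derive_within_co tI).
have C : Ck_on 1 setT (fun x => w x i 0).
  exact: ((Ck_on_mxP 1 w openT).1 (w_smooth 1) i 0).
apply: (is_derive_within_comp openT _ C) => //; apply: dq.
by case/andP: tI => /ltW -> ->.
Qed.

Variables (qf pf : 'cV[R]_d) (r : R) (omega : 'cV[R]_2).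
Hypothesis q_lim : q t @[t --> t1^'-] --> qf.
Hypothesis p_lim : p t @[t --> t1^'-] --> pf.
Hypothesis w_qf : w qf = 0.
Hypothesis r_gt0 : 0 < r.
Hypothesis omega1 : enorm omega = 1.
Hypothesis dwE : jacobian_mx w qf *m pf = r *: omega.

(** The derivative of [w (q t)] is dw(q) p, which tends to dw(qf) pf = r omega; only the limits of
    [q] and [p] at [t1] enter, no derivative there. *)
Let wq_slope i : w (q t) i 0 / (t - t1) @[t --> t1^'-] --> r * omega i 0.
Proof.
have Cw : Ck_on 1 setT (fun x => w x i 0).
  exact: ((Ck_on_mxP 1 w openT).1 (w_smooth 1) i 0).
apply: (@lhopital_at_left R _
  (fun t => \sum_l p t l 0 * partial l (fun x => w x i 0) (q t)) _ (cst 1) t0 t1) => //.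
- by move=> t; rewrite in_itv/= => /dwq.
- move=> t _; have := is_deriveB (is_derive_id t (1 : R)) (is_derive_cst t1 t (1 : R)).
  by rewrite subr0.
- have := cvg_comp _ _ q_lim (Cw.1 qf I); by rewrite w_qf mxE.
- have -> : (0 : R) = t1 - t1 by rewrite subrr.
  by apply: cvgB; [exact: cvg_at_left_filter|exact: cvg_cst].
- by move=> t _; exact: oner_neq0.
have -> : (fun t => (\sum_l p t l 0 * partial l (fun x => w x i 0) (q t)) / cst 1 t) =
    (fun t => \sum_l p t l 0 * partial l (fun x => w x i 0) (q t)).
  by apply/funext => t; rewrite divr1.
have -> : r * omega i 0 = \sum_l pf l 0 * partial l (fun x => w x i 0) qf.
  have <- : (r *: omega) i 0 = r * omega i 0 by rewrite mxE.
  by rewrite -dwE mxE; apply: eq_bigr => l _; rewrite mxE mulrC.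
apply: cvg_big => [|l _]; first exact: add_continuous.
apply: cvgM; first exact: (iffLR (cvg_mxP _ _ _) p_lim l 0).
exact: (cvg_comp _ _ q_lim ((Cw.2 l).2.1 qf I)).
Qed.

(** With [rho] the quotient of [w (q t)] by [t - t1] and [n] its norm, |w| = (t1 - t) n. The
    numerator carries t - t1 instead, and this is the source of the minus sign. *)
Let wq_direction i : (enorm (w (q t)))^-1 * w (q t) i 0 @[t --> t1^'-] --> - omega i 0.
Proof.
pose rho t i := w (q t) i 0 / (t - t1).
pose n t := Num.sqrt (rho t 0 ^+ 2 + rho t 1 ^+ 2).
have nr : n t @[t --> t1^'-] --> r.
  have -> : r = Num.sqrt ((r * omega 0 0) ^+ 2 + (r * omega 1 0) ^+ 2).
    rewrite 2!exprMn -mulrDr -enorm2_sqr omega1 expr1n mulr1 sqrtr_sqr ger0_norm//.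
    exact: ltW.
  have rho2 : rho t 0 ^+ 2 + rho t 1 ^+ 2 @[t --> t1^'-] -->
      (r * omega 0 0) ^+ 2 + (r * omega 1 0) ^+ 2.
    have S j : rho t j ^+ 2 @[t --> t1^'-] --> (r * omega j 0) ^+ 2.
      have -> : (fun t => rho t j ^+ 2) = (fun t => rho t j * rho t j).
        by apply/funext => t; rewrite expr2.
      by rewrite expr2; apply: cvgM; exact: wq_slope.
    exact: cvgD (S 0) (S 1).
  exact: (cvg_comp _ _ rho2 (@sqrt_continuous R _)).
have : - (rho t i / n t) @[t --> t1^'-] --> - (r * omega i 0 / r).
  apply: cvgN; apply: cvgM; first exact: wq_slope.
  by apply: cvgV => //; rewrite gt_eqF.
rewrite mulrAC divff ?gt_eqF// mul1r; apply: cvg_trans; apply: near_eq_cvg.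
near=> t.
have tt1 : 0 < t1 - t by rewrite subr_gt0; near: t; exact: nbhs_left_lt.
have wE j : w (q t) j 0 = rho t j * (t - t1).
  by rewrite /rho divfK// -opprB oppr_eq0 gt_eqF.
have eE : enorm (w (q t)) = (t1 - t) * n t.
  rewrite /enorm sum_ord2 !wE [in LHS]exprMn [X in _ + X]exprMn -mulrDl sqrtrM ?addr_ge0 ?sqr_ge0//.
  by rewrite sqrtr_sqr distrC gtr0_norm// mulrC.
rewrite eE wE -(opprB t1 t) mulrN invfM mulrN; congr (- _).
by rewrite [RHS]mulrC mulrA mulfK ?gt_eqF.
Unshelve. all: by end_near. Qed.

Lemma PiN1_trajectory_cvg i j : Pi w (-1) (q t) i j @[t --> t1^'-] -->
  2^-1 * ((i == j)%:R + Amx omega i j).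
Proof.
have -> : (fun t => Pi w (-1) (q t) i j) = (fun t =>
    2^-1 * ((i == j)%:R + - ((enorm (w (q t)))^-1 * Amx (w (q t)) i j))).
  by apply/funext => t; rewrite PiE mulN1r.
apply: cvgMl_tmp; apply: cvgD; first exact: cvg_cst.
rewrite -[X in _ --> X]opprK; apply: cvgN.
(* Every entry of A(u) is a coordinate of u, except the last diagonal one, which is the opposite of
   a coordinate and is treated apart. *)
have dirE k : (fun t => (enorm (w (q t)))^-1 * Amx (w (q t)) i j) =
    (fun t => (enorm (w (q t)))^-1 * w (q t) k 0) -> Amx omega i j = omega k 0 ->
    (enorm (w (q t)))^-1 * Amx (w (q t)) i j @[t --> t1^'-] --> - Amx omega i j.
  by move=> -> ->.
move: i j dirE; apply: ord2P; apply: ord2P => dirE.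
- by apply: (dirE 0) => //; [apply/funext => t|]; rewrite mxE.
- by apply: (dirE 1) => //; [apply/funext => t|]; rewrite mxE.
- by apply: (dirE 1) => //; [apply/funext => t|]; rewrite mxE.
have -> : (fun t => (enorm (w (q t)))^-1 * Amx (w (q t)) 1 1) =
    (fun t => - ((enorm (w (q t)))^-1 * w (q t) 0 0)).
  by apply/funext => t; rewrite mxE/= mulrN.
by rewrite mxE/=; apply: cvgN.
Qed.

End Trajectory.

(** * Transport of the eigenvector along the trajectory, and the conclusion *)

Lemma eigenvector_transport (R : realType) (d : nat) (w : 'cV[R]_d -> 'cV[R]_2)
    (t0 t1 : R) (q p : R -> 'cV[R]_d) (Y : R -> 'cV[R]_2) :
  smooth_on setT w -> t0 < t1 ->
  (forall t, t0 <= t < t1 -> w (q t) <> 0) ->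
  (forall t, t0 <= t < t1 -> is_derive_within `[t0, t1[%classic q t (p t)) ->
  (forall t, t0 <= t < t1 ->
    is_derive_within `[t0, t1[%classic Y t (Bmx w (-1) (q t) (p t) *m Y t)) ->
  Pi w (-1) (q t0) *m Y t0 = Y t0 ->
  forall t, t0 <= t < t1 ->
    Pi w (-1) (q t) *m Y t = Y t /\ enorm (Y t) = enorm (Y t0).
Proof.
move=> Cw t01 w0 dq dY Y0 t tI; pose Z := [set x | w x <> 0].
have t0I : t0 <= t0 < t1 by rewrite lexx.
have oI s : t0 < s < t1 -> t0 <= s < t1 by case/andP => /ltW -> ->.
have oZ : open Z by apply: open_off_Upsilon => x; exact: (Cw 0%N).1.
have CPi n : Ck_on n Z (Pi w 1).
  by apply: Ck_on_Pi => //; apply: Ck_on_sub (Cw n).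
have CP i j : Ck_on 1 Z (fun x => Pi w 1 x i j).
  exact: ((Ck_on_mxP 1 _ oZ).1 (CPi 1%N) i j).
(* The time derivative of Pi_+ along the trajectory. Symmetry and constant trace give it the shape
   [a', b'; b', - a']. *)
pose dP i j s := \sum_l p s l 0 * partial l (fun x => Pi w 1 x i j) (q s).
have dPq i j s : t0 <= s < t1 -> is_derive_within `[t0, t1[%classic
    (fun s' => Pi w 1 (q s') i j) s (dP i j s).
  move=> sI; exact: (is_derive_within_comp oZ (w0 s sI) (CP i j) (dq s sI)).
have dP10 s : dP 1 0 s = dP 0 1 s.
  rewrite /dP; have -> // : (fun x => Pi w 1 x 1 0) = (fun x => Pi w 1 x 0 1).
  by apply/funext => x; rewrite !PiE !mxE.
have dP11 s : t0 <= s < t1 -> dP 1 1 s = - dP 0 0 s.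
  move=> sI; rewrite /dP -sumrN; apply: eq_bigr => l _; rewrite -mulrN; congr (_ * _).
  have -> : (fun x => Pi w 1 x 1 1) = (fun x => 1 - Pi w 1 x 0 0).
    by apply/funext => x; rewrite !PiE !mxE/=; move: (enorm _)^-1 => n; field.
  have D := ((CP 0 0).2 l).1 _ (w0 s sI).
  by have := deriveB (derivable_cst (1 : R) (q s) (delta_mx l 0)) D;
    rewrite derive_cst sub0r.
(* For the minus sign, B_- Y = - P D (Pi_- Y) with P = Pi_+; this is the coordinate form of the
   equation in the transport lemma. *)
have YE i s : t0 <= s < t1 -> (Bmx w (-1) (q s) (p s) *m Y s) i 0 =
    - (Pi w 1 (q s) i 0 * (dP 0 0 s * (Pi w (-1) (q s) *m Y s) 0 0 +
                           dP 0 1 s * (Pi w (-1) (q s) *m Y s) 1 0) +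
       Pi w 1 (q s) i 1 * (dP 0 1 s * (Pi w (-1) (q s) *m Y s) 0 0 -
                           dP 0 0 s * (Pi w (-1) (q s) *m Y s) 1 0)).
  move=> sI; rewrite /Bmx opprK -scalemxAl -!mulmxA scaleN1r mxE.
  move: (Pi w (-1) (q s) *m Y s) => z; rewrite !mulmx2E.
  rewrite !(directional_mxE _ _ _ (CPi 2%N) (w0 s sI)).
  by rewrite -!/(dP _ _ s) dP10 dP11// mulNr.
pose a s := Pi w 1 (q s) 0 0; pose b s := Pi w 1 (q s) 0 1.
have PiNY s : t0 <= s < t1 ->
    (Pi w (-1) (q s) *m Y s) 0 0 = Y s 0 0 - (a s * Y s 0 0 + b s * Y s 1 0) /\
    (Pi w (-1) (q s) *m Y s) 1 0 = Y s 1 0 - (b s * Y s 0 0 + (1 - a s) * Y s 1 0).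
  move=> sI; have [P10 P11 _] := Pi1_idem (w0 s sI).
  by rewrite !mulmx2E !PiN1_coordE P10 P11 /=; split; rewrite /a /b; ring.
have dYi i s : t0 <= s < t1 -> is_derive_within `[t0, t1[%classic
    (fun s' => Y s' i 0) s ((Bmx w (-1) (q s) (p s) *m Y s) i 0).
  by move=> sI; exact: is_derive_within_mx (dY s sI).
have := (PiN1_fixE _ (w0 t0 t0I)).1 Y0; case=> z0 z1.
have [|||||||||||Z0 Z1 E] := @parallel_transport R t0 t1 a b (fun s => Y s 0 0)
  (fun s => Y s 1 0) (dP 0 0) (dP 0 1) _ _ _ _ _ _ _ _ _ _ _ t tI.
- by move=> s sI; have [] := Pi1_idem (w0 s sI).
- exact: is_derive_within_right t01 (dPq 0 0 t0 t0I).
- exact: is_derive_within_right t01 (dPq 0 1 t0 t0I).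
- exact: is_derive_within_right t01 (dYi 0 t0 t0I).
- exact: is_derive_within_right t01 (dYi 1 t0 t0I).
- by move=> s sI; exact: is_derive_within_co sI (dPq 0 0 s (oI s sI)).
- by move=> s sI; exact: is_derive_within_co sI (dPq 0 1 s (oI s sI)).
- move=> s sI; have [Y0' Y1'] := PiNY s (oI s sI).
  have := is_derive_within_co sI (dYi 0 s (oI s sI)).
  by rewrite (YE _ _ (oI s sI)) Y0' Y1'.
- move=> s sI; have [Y0' Y1'] := PiNY s (oI s sI).
  have [P10 P11 _] := Pi1_idem (w0 s (oI s sI)).
  have := is_derive_within_co sI (dYi 1 s (oI s sI)).
  by rewrite (YE _ _ (oI s sI)) Y0' Y1' P10 P11.
- exact: z0.
- exact: z1.
split; first by apply/PiN1_fixE; [exact: w0|split].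
by rewrite /enorm !sum_ord2 E.
Qed.

Theorem proposition1p4 (R : realType) (d : nat)
  (v : 'cV[R]_d -> R) (w : 'cV[R]_d -> 'cV[R]_2)
  (v_smooth : smooth_on setT v) (w_smooth : smooth_on setT w)
  (V_subquadratic : forall gam : 'I_d -> nat, (2 <= \sum_i gam i)%N ->
    exists M : R, forall x, `|multi_partial gam (Vmx v w) x| <= M)
  (gap : exists c0 n0 r0 : R, [/\ 0 < c0, 0 < n0, 0 < r0
    & forall x, r0 <= enorm (w x) ->
        c0 * bracket x `^ (- n0) <= `|lambda v w 1 x - lambda v w (-1) x| ])
  (dw_rank : forall x, Upsilon w x -> \rank (jacobian_mx w x) = 2%N)
  (t0 tflat : R) (q0 p0 qflat pflat : 'cV[R]_d) (q p : R -> 'cV[R]_d)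
  (q0_off : w q0 <> 0) (t0_lt : t0 < tflat)
  (traj : hamiltonian_trajectory v w (-1) `[t0, tflat[%classic q p)
  (q_init : q t0 = q0) (p_init : p t0 = p0)
  (q_reaches : q t @[t --> tflat^'-] --> qflat)
  (p_reaches : p t @[t --> tflat^'-] --> pflat)
  (crossing : nondegenerate_crossing w qflat pflat)
  (r : R) (omega : 'cV[R]_2) (r_gt0 : 0 < r) (omega_unit : enorm omega = 1)
  (dwE : jacobian_mx w qflat *m pflat = r *: omega)
  (Y0 : 'cV[R]_2) (Y0_unit : enorm Y0 = 1) (Y0_eig : Pi w (-1) q0 *m Y0 = Y0)
  (Y : R -> 'cV[R]_2) (Y_init : Y t0 = Y0)
  (Y_ode : forall t, t \in `[t0, tflat[ ->
     is_derive_within `[t0, tflat[%classic Y t (Bmx w (-1) (q t) (p t) *m Y t)) :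
  [/\ forall t, t \in `[t0, tflat[ -> Pi w (-1) (q t) *m Y t = Y t,
      exists Vomega : 'cV[R]_2,
        [/\ enorm Vomega = 1, Y t @[t --> tflat^'-] --> Vomega
          & Amx omega *m Vomega = Vomega]
    & exists (tau : R) (U : set 'cV[R]_d) (Vm : 'cV[R]_d -> 'cV[R]_2),
        [/\ 0 < tau /\ t0 <= tflat - tau,
            open U /\ q @` `[tflat - tau, tflat[%classic `<=` U,
            smooth_on U Vm,
            forall x, U x -> w x <> 0 /\ Pi w (-1) x *m Vm x = Vm x
          & forall t, t \in `[tflat - tau, tflat[ -> Y t = Vm (q t)]].
Proof.
have w0 t : t0 <= t < tflat -> w (q t) <> 0.
  by move=> tI; have [|] := traj t; rewrite ?/= ?in_itv.
have dq t : t0 <= t < tflat -> is_derive_within `[t0, tflat[%classic q t (p t).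
  by move=> tI; have [|] := traj t; rewrite ?/= ?in_itv.
have dY t : t0 <= t < tflat -> is_derive_within `[t0, tflat[%classic Y t
    (Bmx w (-1) (q t) (p t) *m Y t).
  by move=> tI; apply: Y_ode; rewrite in_itv.
have YP t : t0 <= t < tflat -> Pi w (-1) (q t) *m Y t = Y t /\ enorm (Y t) = 1.
  move=> tI; have Yt0 : Pi w (-1) (q t0) *m Y t0 = Y t0 by rewrite Y_init q_init.
  have [YP ->] := eigenvector_transport w_smooth t0_lt w0 dq dY Yt0 tI.
  by rewrite Y_init.
have [V [V1 AV]] := Amx_eigenvector omega_unit.
pose Q : 'M[R]_2 := 2^-1 *: (1%:M + Amx omega).
have QV : Q *m V = V.
  have VV : V + V = 2 *: V by rewrite scaler_nat mulr2n.
  by rewrite -scalemxAl mulmxDl mul1mx AV VV scalerA mulVf ?scale1r.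
have PQ i j : Pi w (-1) (q t) i j @[t --> tflat^'-] --> Q i j.
  rewrite (_ : Q i j = 2^-1 * ((i == j)%:R + Amx omega i j)); last by rewrite !mxE.
  exact: (PiN1_trajectory_cvg w_smooth t0_lt dq q_reaches p_reaches crossing.1
    r_gt0 omega_unit dwE).
have [oF eF] := unit_projection_cvg _ V1 QV PQ.
pose U := [set x | w x <> 0 /\ 0 < overlap w V x].
have oU : open U by exact: open_unit_projection_dom.
have Ce : smooth_on U (unit_projection w V).
  apply: smooth_unit_projection => // n; exact: Ck_on_sub (w_smooth n).
have [tau [tau0 tauI qU]] : exists tau, [/\ 0 < tau, t0 < tflat - tau &
    forall t, tflat - tau <= t < tflat -> U (q t)].
  have : nbhs tflat (fun t => t < tflat -> 0 < overlap w V (q t)).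
    exact: (cvgr_gt _ oF _ ltr01).
  move=> /nbhs_ballP[rho /= rho0 H].
  (* Taking half of [m] keeps [t0 < tflat - tau] strict, so that [q] and [Y] have two-sided
     derivatives, hence are continuous, at every point of the final interval, left end included. *)
  pose m := Num.min rho (tflat - t0).
  have m0 : 0 < m by rewrite lt_min rho0 subr_gt0.
  have [mrho mt] : m <= rho /\ m <= tflat - t0 by rewrite /m ge_min lexx ge_min lexx orbT.
  exists (m / 2); split; [lra|lra|move=> t /andP[tm tf]].
  split; first by apply: w0; apply/andP; split=> //; lra.
  by apply: H => //; rewrite -ball_normE/= gtr0_norm; lra.
pose J t := tflat - tau <= t < tflat.
have J0 t : J t -> t0 < t < tflat by move=> /andP[h ->]; rewrite (lt_le_trans tauI h).
have Jc t : J t -> t0 <= t < tflat by move=> /J0/andP[/ltW -> ->].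
pose e t := unit_projection w V (q t).
pose s t := Y t 0 0 * e t 0 0 + Y t 1 0 * e t 1 0.
have Ys t : J t -> Y t = s t *: e t /\ s t ^+ 2 = 1.
  move=> tJ; have [YP1 YP2] := YP t (Jc t tJ).
  have [qw qo] := qU t tJ; have [eP1 eP2] := unit_projectionP qw qo.
  exact: (PiN1_unit_colinear qw YP2 eP2 YP1 eP1).
have cs t : J t -> {for t, continuous s}.
  move=> tJ; have tJ0 := J0 t tJ.
  have cvec (n : nat) (M : R -> 'cV[R]_n) l : is_derive t (1 : R) M l -> {for t, continuous M}.
    by move=> [dM _]; apply: differentiable_continuous; exact/derivable1_diffP.
  have cY := cvec _ _ _ (is_derive_within_co tJ0 (dY t (Jc t tJ))).
  have cq := cvec _ _ _ (is_derive_within_co tJ0 (dq t (Jc t tJ))).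
  have ce : e u @[u --> t] --> e t := cvg_comp _ _ cq ((Ce 0%N).1 _ (qU t tJ)).
  have coord (M : R -> 'cV[R]_2) i : {for t, continuous M} ->
    M u i 0 @[u --> t] --> M t i 0.
    by move=> cM; exact: (iffLR (cvg_mxP (nbhs_filter t) _ _) cM i 0).
  by apply: cvgD; apply: cvgM; exact: coord.
pose sg := s (tflat - tau).
have Jl : J (tflat - tau) by rewrite /J lexx ltrBlDr ltrDl.
have sg2 : sg ^+ 2 = 1 by have [] := Ys _ Jl.
have sE t : J t -> s t = sg.
  move=> tJ; have [_ s2] := Ys t tJ; have [//|ne] := eqVneq (s t) sg.
  have : s t ^+ 2 == sg ^+ 2 by rewrite s2 sg2.
  rewrite eqf_sqr (negbTE ne)/= => /eqP sN.
  have tl : tflat - tau <= t by case/andP: tJ.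
  have tJl u : u \in `[tflat - tau, t] -> J u.
    rewrite in_itv/= /J => /andP[-> ut]; rewrite (le_lt_trans ut)//.
    by case/andP: tJ.
  have [||c /tJl cJ c0] := @IVT R s (tflat - tau) t 0 tl.
  - by apply: continuous_in_subspaceT => u /set_mem /tJl; exact: cs.
  - rewrite -/sg sN ge_min le_max !oppr_le0 !oppr_ge0.
    by have /orP[->|->] := le_total 0 sg; rewrite ?orbT.
  have [_ /eqP] := Ys c cJ.
  by rewrite c0 expr0n/= eq_sym oner_eq0.
have YE t : J t -> Y t = sg *: e t by move=> tJ; rewrite -(sE t tJ); exact: (Ys t tJ).1.
split.
- by move=> t; rewrite in_itv/= => tI; exact: (YP t tI).1.
(* [omega] determines [V] only up to sign; [sg] is the sign selected by the solution. *)
- exists (sg *: V); split.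
  + rewrite /enorm sum_ord2 !(mxE scalemx_key) !exprMn sg2 !mul1r.
    by rewrite -enorm2_sqr V1 expr1n sqrtr1.
  + have eS : sg *: e t @[t --> tflat^'-] --> sg *: V by exact: cvgZl_tmp.
    apply: cvg_trans eS; apply: near_eq_cvg; near=> t.
    rewrite /= YE// /J; apply/andP; split; near: t; last exact: nbhs_left_lt.
    by apply: nbhs_left_ge; rewrite ltrBlDr ltrDl.
  + by rewrite -scalemxAr AV.
exists tau, U, (fun x => sg *: unit_projection w V x); split.
- by split=> //; exact: ltW.
- split=> // _ [t /= tI <-]; apply: qU.
  by move: tI; rewrite in_itv.
- move=> n; apply/(Ck_on_mxP _ _ oU) => i j.
  have := Ck_onM oU (Ck_on_cst n sg oU) ((Ck_on_mxP n _ oU).1 (Ce n) i j).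
  by apply: Ck_on_eq => // x _; rewrite [RHS](mxE scalemx_key).
- move=> x [xw xo]; split=> //; rewrite -scalemxAr.
  by rewrite (unit_projectionP xw xo).1.
- by move=> t; rewrite in_itv/= => tI; exact: YE.
Unshelve. all: by end_near. Qed.
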